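(* Let $Q$, $Q'$ be Moufang loops, and let $N=N(Q)$ be the nucleus of $Q$. Suppose that in the factor loop $Q/N$ the squaring map $xN\mapsto x^2N$ is surjective. Then every half-isomorphism of $Q$ onto $Q'$ is either an isomorphism or an anti-isomorphism.
   Context: A loop $(Q,\cdot)$ is a set $Q$ with a binary operation such that for all $a,b\in Q$ the equations $a\cdot x=b$ and $y\cdot a=b$ have unique solutions $x,y\in Q$, and there is a neutral element $1\in Q$ with $1\cdot x=x\cdot 1=x$ for all $x\in Q$. Juxtaposition binds more tightly than $\cdot$, so $xy\cdot z$ means $(x\cdot y)\cdot z$. A Moufang loop is a loop satisfying any (equivalently all) of the identities $xy\cdot zx=x(yz\cdot x)$, $(xy\cdot x)z=x(y\cdot xz)$, $(zx\cdot y)x=z(x\cdot yx)$. The nucleus of a loop $Q$ is $N(Q)=\{a\in Q \mid ax\cdot y=a\cdot xy,\ xa\cdot y=x\cdot ay,\ xy\cdot a=x\cdot ya \text{ for all } x,y\in Q\}$. If $Q$ is a Moufang loop, $N(Q)$ is a normal subloop, so the factor loop $Q/N(Q)$ is defined. A mapping $\varphi:Q\to Q'$ of loops is a half-homomorphism if for every $x,y\in Q$ either $\varphi(xy)=\varphi(x)\cdot\varphi(y)$ or $\varphi(xy)=\varphi(y)\cdot\varphi(x)$ (the choice may depend on $x,y$). A half-isomorphism is a bijective half-homomorphism. An anti-isomorphism is a bijection $\varphi$ with $\varphi(xy)=\varphi(y)\cdot\varphi(x)$ for all $x,y\in Q$. *)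

(* Defs.v *)
From HB Require Import structures.
From mathcomp Require Import all_boot.
From mathcomp Require Import boolp classical_sets.

Set Implicit Arguments.
Unset Strict Implicit.
Unset Printing Implicit Defensive.

Local Open Scope classical_set_scope.
Local Open Scope group_scope.

(* [umagmaType] is not used as a base because it carries a choice operator,
   which a bare loop does not have. *)
HB.mixin Record BaseUMagma_isLoop Q of BaseUMagma Q := {
  loop1g : left_id 1 (@mul Q);
  loopg1 : right_id 1 (@mul Q);
  ldiv_unique : forall a b : Q, exists! x, a * x = b;
  rdiv_unique : forall a b : Q, exists! y, y * a = b
}.

#[short(type="loopType")]
HB.structure Definition Loop := {Q of BaseUMagma_isLoop Q & BaseUMagma Q}.

(* The three Moufang identities are equivalent in a loop. *)
Definition moufang (Q : loopType) : Prop :=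
  forall x y z : Q, (x * y) * (z * x) = x * ((y * z) * x).

Definition nucleus (Q : loopType) : set Q := [set a | forall x y : Q,
  [/\ (a * x) * y = a * (x * y),
      (x * a) * y = x * (a * y) &
      (x * y) * a = x * (y * a)]].

Arguments nucleus : clear implicits.

Definition lcoset (Q : loopType) (a : Q) (N : set Q) : set Q :=
  [set a * n | n in N].

Definition rcoset (Q : loopType) (N : set Q) (a : Q) : set Q :=
  [set n * a | n in N].

Definition setmul (Q : loopType) (A B : set Q) : set Q :=
  [set a * b | a in A & b in B].

(* The last two fields say that [S] is closed under left and right division,
   so that [S] is a loop under the restricted operation. *)
Record subloop (Q : loopType) (S : set Q) : Prop := {
  subloop1 : S 1;
  subloopM : forall a b, S a -> S b -> S (a * b);
  subloopl : forall a x, S a -> S (a * x) -> S x;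
  subloopr : forall a y, S a -> S (y * a) -> S y
}.

Record normal_subloop (Q : loopType) (N : set Q) : Prop := {
  normal_sub : subloop N;
  normalJ : forall x, lcoset x N = rcoset N x;
  normalL : forall x y, lcoset x (lcoset y N) = lcoset (x * y) N;
  normalR : forall x y, rcoset (rcoset N x) y = rcoset N (x * y)
}.

Section LoopTheory.
Variable Q : loopType.
Implicit Types a b x y z : Q.

Lemma loopIl a x y : a * x = a * y -> x = y.
Proof.
move=> e; have [z [_ uz]] := ldiv_unique a (a * y).
by rewrite -(uz x e) -(uz y erefl).
Qed.

Lemma loopIr a x y : x * a = y * a -> x = y.
Proof.
move=> e; have [z [_ uz]] := rdiv_unique a (y * a).
by rewrite -(uz x e) -(uz y erefl).
Qed.

Variables (N : set Q) (nN : normal_subloop N).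

Lemma lcoset_refl a : lcoset a N a.
Proof. by exists 1; [exact: subloop1 (normal_sub nN) | rewrite loopg1]. Qed.

Lemma lcoset_mem n : N n -> lcoset n N = N.
Proof.
move=> Nn; apply/seteqP; split=> [_ [m Nm <-]|m Nm].
  exact: subloopM (normal_sub nN) _ _ Nn Nm.
have [z [ez _]] := ldiv_unique n m.
by exists z => //; apply: (subloopl (normal_sub nN) Nn); rewrite ez.
Qed.

Lemma lcoset_eq a b : lcoset a N b -> lcoset b N = lcoset a N.
Proof. by case=> n Nn <-; rewrite -(normalL nN) lcoset_mem. Qed.

Lemma setmul_lcoset a b :
  setmul (lcoset a N) (lcoset b N) = lcoset (a * b) N.
Proof.
apply/seteqP; split=> [_ [x ax [y [n Nn <-] <-]]|].
  have xb : lcoset (a * b) N (x * b).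
    rewrite (normalJ nN) -(normalR nN) -(normalJ nN).
    by exists x.
  rewrite -(lcoset_eq xb) -(normalL nN).
  by exists (b * n) => //; exists n.
move=> _ [n Nn <-].
have : lcoset (a * b) N ((a * b) * n) by exists n.
rewrite -(normalL nN) => -[y by_ <-].
by exists a; [exact: lcoset_refl | exists y].
Qed.

End LoopTheory.

(* The multiplication is the product of subsets; by [setmul_lcoset] it sends
   [(aN, bN)] to [(ab)N]. *)
Definition factor (Q : loopType) (N : set Q) (nN : normal_subloop N) : Type :=
  {C : set Q | exists a, C = lcoset a N}.

Section Factor.
Variables (Q : loopType) (N : set Q) (nN : normal_subloop N).

Definition factor_pi (a : Q) : factor nN :=
  exist _ (lcoset a N) (ex_intro _ a erefl).

Fact factor_mul_subproof (C D : factor nN) :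
  exists a, setmul (sval C) (sval D) = lcoset a N.
Proof.
have [[a ->] [b ->]] := (svalP C, svalP D).
by exists (a * b); exact: setmul_lcoset.
Qed.

Definition factor_mul (C D : factor nN) : factor nN :=
  exist _ (setmul (sval C) (sval D)) (factor_mul_subproof C D).

HB.instance Definition _ := hasMul.Build (factor nN) factor_mul.
HB.instance Definition _ := hasOne.Build (factor nN) (factor_pi 1).

Lemma factor_eq (C D : factor nN) : sval C = sval D -> C = D.
Proof. by case: C D => [A hA] [B hB] /= eAB; exact: eq_exist. Qed.

Lemma factor_ind (P : factor nN -> Prop) :
  (forall a, P (factor_pi a)) -> forall C, P C.
Proof.
move=> H C; case: (svalP C) => a eC.
by rewrite (_ : C = factor_pi a) //; exact: factor_eq.
Qed.

Lemma factor_piM a b : factor_pi (a * b) = factor_pi a * factor_pi b.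
Proof. by apply: factor_eq => /=; rewrite setmul_lcoset. Qed.

Lemma factor_pi_eq a b : lcoset a N b -> factor_pi b = factor_pi a.
Proof. by move=> ab; apply: factor_eq; exact: lcoset_eq. Qed.

Lemma factor_pi_mem a b : factor_pi b = factor_pi a -> lcoset a N b.
Proof. by move=> [<-]; exact: lcoset_refl. Qed.

Fact factor_1g : left_id (1 : factor nN) (@mul (factor nN)).
Proof. by elim/factor_ind=> a; rewrite -factor_piM loop1g. Qed.

Fact factor_g1 : right_id (1 : factor nN) (@mul (factor nN)).
Proof. by elim/factor_ind=> a; rewrite -factor_piM loopg1. Qed.

Fact factor_ldiv (a b : factor nN) : exists! x, a * x = b.
Proof.
elim/factor_ind: a => a; elim/factor_ind: b => b.
have [x [ex _]] := ldiv_unique a b.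
exists (factor_pi x); split; first by rewrite -factor_piM ex.
elim/factor_ind=> y; rewrite -factor_piM -ex => /factor_pi_mem.
rewrite -(normalL nN) => -[z xz /loopIl e]; apply: esym; apply: factor_pi_eq.
by rewrite -e.
Qed.

Fact factor_rdiv (a b : factor nN) : exists! y, y * a = b.
Proof.
elim/factor_ind: a => a; elim/factor_ind: b => b.
have [x [ex _]] := rdiv_unique a b.
exists (factor_pi x); split; first by rewrite -factor_piM ex.
elim/factor_ind=> y; rewrite -factor_piM -ex => /factor_pi_mem.
rewrite (normalJ nN) -(normalR nN) -(normalJ nN) => -[z xz /loopIr e].
by apply: esym; apply: factor_pi_eq; rewrite -e.
Qed.

HB.instance Definition _ := BaseUMagma_isLoop.Build (factor nN)
  factor_1g factor_g1 factor_ldiv factor_rdiv.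

End Factor.

Section MoufangNucleus.
Variables (Q : loopType) (mQ : moufang Q).
Implicit Types a b n x y z : Q.

Lemma moufang_flex x y : (x * y) * x = x * (y * x).
Proof. by have := mQ x y 1; rewrite loop1g loopg1. Qed.

Lemma moufang_inv x : exists x', x * x' = 1 /\ [/\ x' * x = 1,
  forall z, x * (x' * z) = z, forall z, x' * (x * z) = z,
  forall z, (z * x') * x = z & forall z, (z * x) * x' = z].
Proof.
have [x' [ex _]] := ldiv_unique x 1.
have lip z : x * (x' * z) = z.
  apply: (@loopIr _ x); have := mQ x x' z.
  by rewrite ex loop1g moufang_flex => <-.
have ex' : x' * x = 1 by apply: (@loopIl _ x); rewrite lip loopg1.
have rip z : (z * x') * x = z.
  apply: (@loopIl _ x); have := mQ x z x'.
  by rewrite ex' loopg1 => <-.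
exists x'; split=> //; split=> // z.
- by apply: (@loopIl _ x); rewrite lip.
- by apply: (@loopIr _ x); rewrite rip.
Qed.

Lemma nucleus_left a :
  (forall x y, (a * x) * y = a * (x * y)) -> nucleus Q a.
Proof.
have [i iP] := choice moufang_inv.
have iK x : i (i x) = x.
  have [_ [e2 _ _ _ _]] := iP x; have [e3 [_ _ _ _ _]] := iP (i x).
  by apply: (@loopIl _ (i x)); rewrite e3.
have iM u v : i (u * v) = i v * i u.
  have [_ [_ _ _ _ /(_ u) e1]] := iP v.
  have [_ [_ _ /(_ (i v)) e2 _ _]] := iP (u * v).
  have [_ [_ _ _ _ /(_ (i (u * v))) e3]] := iP u.
  by rewrite -[in LHS]e3 -{2}e1 e2.
move=> la; have [_ [_ aK a'K _ Ka']] := iP a.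
have la' x y : (i a * x) * y = i a * (x * y).
  by apply: (@loopIl _ a); rewrite -la !aK.
move=> x y; split=> //.
- have [_ [_ uK _ _ _]] := iP (x * a).
  rewrite -[RHS](uK); congr (_ * _).
  have [_ [_ _ xK _ _]] := iP x.
  by rewrite iM la' xK a'K.
- by rewrite -[LHS]iK -[RHS]iK; congr (i _); rewrite !iM la'.
Qed.

Lemma nucleus_conj x x' n : x * x' = 1 -> nucleus Q n ->
  nucleus Q (x * (n * x')) /\ x * n = (x * (n * x')) * x.
Proof.
move=> xx' Nn.
have [x2 [xx2 [_ xK x2K Kx Kx2]]] := moufang_inv x.
have -> : x' = x2 by apply: (@loopIl _ x); rewrite xx' xx2.
split; last first.
  by have [_ <- _] := Nn x x2; rewrite Kx.
pose f y := x * (n * (x2 * y)).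
pose g t := x * ((n * (x2 * (t * x2))) * x).
have fg y z : f y * z = g (y * z).
  rewrite -[z in LHS]Kx mQ /g -(mQ x2).
  by have [-> _ _] := Nn (x2 * y) (z * x2).
have gE y : g y = f y by rewrite -[y in LHS]loopg1 -fg loopg1.
have fE y : f y = f 1 * y by rewrite fg loop1g gE.
apply: nucleus_left => y z.
have -> : x * (n * x2) = f 1 by rewrite /f loopg1.
by rewrite -!fE fg gE.
Qed.

Lemma nucleus_normal : normal_subloop (nucleus Q).
Proof.
split.
- split=> [x y|a b Na Nb|a x Na Nax|a y Na Nya].
  + by rewrite !loop1g !loopg1.
  + apply: nucleus_left => x y.
    have [-> _ _] := Na b x; have [-> _ _] := Na (b * x) y.
    by have [-> _ _] := Nb x y; have [-> _ _] := Na b (x * y).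
  + apply: nucleus_left => y z; apply: (@loopIl _ a).
    have [<- _ _] := Na (x * y) z; have [<- _ _] := Na x y.
    have [<- _ _] := Na x (y * z); by have [-> _ _] := Nax y z.
  + have [a' [aa' [_ aK _ _ Ka']]] := moufang_inv a.
    apply: nucleus_left => u v; rewrite -[u]aK.
    have [_ <- _] := Na y (a' * u); have [-> _ _] := Nya (a' * u) v.
    have [_ -> _] := Na y ((a' * u) * v); congr (_ * _).
    by have [-> _ _] := Na (a' * u) v.
- move=> x; have [x' [xx' [x'x xK _ _ _]]] := moufang_inv x.
  apply/seteqP; split=> _ [n Nn <-].
    have [Nm ->] := nucleus_conj xx' Nn.
    by exists (x * (n * x')).
  have [Nm _] := nucleus_conj x'x Nn.
  by exists (x' * (n * x)); rewrite ?xK.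
- move=> x y; apply/seteqP; split=> [_ [_ [n Nn <-] <-]|_ [n Nn <-]].
    by exists n => //; have [_ _ ->] := Nn x y.
  by exists (y * n); [exists n | have [_ _ ->] := Nn x y].
- move=> x y; apply/seteqP; split=> [_ [_ [n Nn <-] <-]|_ [n Nn <-]].
    by exists n => //; have [-> _ _] := Nn x y.
  by exists (n * x); [exists n | have [-> _ _] := Nn x y].
Qed.

End MoufangNucleus.

Definition squaring_surjective (L : loopType) : Prop :=
  forall C : L, exists D : L, D * D = C.

Definition half_homomorphism (Q Q' : loopType) (phi : Q -> Q') : Prop :=
  forall x y, phi (x * y) = phi x * phi y \/ phi (x * y) = phi y * phi x.

Definition half_isomorphism (Q Q' : loopType) (phi : Q -> Q') : Prop :=
  bijective phi /\ half_homomorphism phi.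

Definition isomorphism (Q Q' : loopType) (phi : Q -> Q') : Prop :=
  bijective phi /\ {morph phi : x y / x * y}.

Definition anti_isomorphism (Q Q' : loopType) (phi : Q -> Q') : Prop :=
  bijective phi /\ {morph phi : x y / x * y >-> y * x}.

(* Main.v *)
(* Call a noncommuting pair (x, y) straight if phi(xy) = phi(x)phi(y) and
   twisted if phi(xy) = phi(y)phi(x). Suppose that x is mixed, that is, (x, y)
   is straight and (x, z) is twisted. Then y and z do not commute; replacing Q'
   by its opposite if necessary, (y, z) is straight, and applying phi to
   x(yz)x = xy.zx gives x y x^-1 = z^-1 y z. The right-hand side does not
   depend on x, and this has two consequences. First, neither y nor z can be in
   the nucleus N, so N commutes with every mixed element, and comparing z with
   nz for n in N shows that N also commutes with y. Second, if x = c^2 n with n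
   in N, then (c, y) is straight and (c, z) is twisted, so
   c y c^-1 = z^-1 y z = x y x^-1 = c^2 y c^-2 and c
   commutes with y, a contradiction. Hence no element is mixed. Finally, if
   (x, y) is straight and (z, w) is twisted, then all of x, y commute with all
   of z, w, and xz is mixed: (xz, yz) is straight and (xz, xw) is twisted. *)

Require Import Defs.
From HB Require Import structures.
From mathcomp Require Import all_boot.
From mathcomp Require Import boolp classical_sets.

Set Implicit Arguments.
Unset Strict Implicit.
Unset Printing Implicit Defensive.

Local Open Scope group_scope.

(** An alias of the carrier: a map into [Q'] is by conversion also a map into its opposite loop. *)
Definition opposite (Q : loopType) : Type := Q.

Section Opposite.
Variable Q : loopType.

HB.instance Definition _ := hasMul.Build (opposite Q) (fun a b : Q => b * a).
HB.instance Definition _ := hasOne.Build (opposite Q) (1 : Q).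
HB.instance Definition _ := BaseUMagma_isLoop.Build (opposite Q)
  (@loopg1 Q) (@loop1g Q) (@rdiv_unique Q) (@ldiv_unique Q).

Lemma opposite_moufang : moufang Q -> moufang (opposite Q).
Proof.
by move=> mQ x y z; rewrite {1 2 3}/mul /= mQ -(moufang_flex mQ).
Qed.

End Opposite.

(** * Consequences of the Moufang identity *)

Section MoufangIdentities.
Variables (Q : loopType) (mQ : moufang Q).
Implicit Types x y z : Q.

(** Take [moufang] with middle element [y * (x * z)] and [q = (xz)^-1]; then [qx = z^-1] cancels. *)
Lemma left_moufang x y z : x * (y * (x * z)) = (x * (y * x)) * z.
Proof.
have [x' [_ [_ _ x'K Kx _]]] := moufang_inv mQ x.
have [z' [_ [_ _ z'K Kz _]]] := moufang_inv mQ z.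
have [q [_ [_ _ _ _ Kq]]] := moufang_inv mQ (x * z).
have zq : z * q = x' by rewrite -[z in LHS](x'K) Kq.
have qx : q * x = z' by rewrite -[q](z'K) zq Kx.
by have := mQ x (y * (x * z)) q; rewrite Kq qx => <-; rewrite Kz.
Qed.

Lemma left_alternative x y : x * (x * y) = (x * x) * y.
Proof. by have := left_moufang x 1 y; rewrite !loop1g. Qed.

End MoufangIdentities.

Section MoreMoufangIdentities.
Variables (Q : loopType) (mQ : moufang Q).
Implicit Types x y z : Q.

Lemma right_moufang x y z : ((z * x) * y) * x = z * ((x * y) * x).
Proof. exact: (left_moufang (opposite_moufang mQ) x y z). Qed.

Lemma right_alternative x y : (y * x) * x = y * (x * x).
Proof. exact: (left_alternative (opposite_moufang mQ) x y). Qed.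

(** [right_moufang] at [x^-1] and twice [w * x] isolates [w * w]. *)
Lemma sqrM x y : (x * y) * (x * y) = x * (y * (x * y)).
Proof.
have [x' [_ [_ _ x'K _ Kx']]] := moufang_inv mQ x; set w := x * y.
have := right_moufang x' (w * x) (w * x); rewrite [(w * x) * x']Kx'.
rewrite (left_alternative mQ) Kx' [w * x](moufang_flex mQ) x'K Kx' => ->.
by rewrite (left_moufang mQ).
Qed.

End MoreMoufangIdentities.

(** * Half-homomorphisms of Moufang loops *)

Section HalfHomomorphism.
Variables (Q Q' : loopType) (mQ : moufang Q) (mQ' : moufang Q').
Variables (phi : Q -> Q') (hphi : half_homomorphism phi).
Implicit Types x y z : Q.

Let half_hom_comm_aux x y : x * y = y * x -> phi (x * y) = phi x * phi y ->
  phi x * phi y = phi y * phi x.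
Proof.
move=> xy pxy; apply: contrapT => ne.
have sq z : phi (z * z) = phi z * phi z by case: (hphi z z).
(* Bracketing as [(xy)y] and as [x(yy)], any other value makes the images commute. *)
have pxyy : phi (x * (y * y)) = phi x * (phi y * phi y).
  have [|] := hphi (x * y) y; rewrite pxy (right_alternative mQ).
    by rewrite (right_alternative mQ').
  move=> e1; have [|] := hphi x (y * y); rewrite sq // e1 => e2.
  by case: ne; apply: (@loopIl _ (phi y)); rewrite e2 left_alternative.
(* In the image of [(xy)^2 = (xy^2)x], either order of the factors [xy^2] and [x] cancels down to
   commuting images. *)
have exy : (x * y) * (x * y) = (x * (y * y)) * x.
  by rewrite {2}xy mQ moufang_flex.
have := sq (x * y); rewrite exy pxy.
have [|] := hphi (x * (y * y)) x; rewrite pxyy => ->.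
  by rewrite (moufang_flex mQ') -mQ' => /loopIl /esym.
rewrite -(right_alternative mQ') (sqrM mQ') => /loopIl.
by rewrite -(moufang_flex mQ') => /loopIr.
Qed.

Lemma half_hom_comm x y : x * y = y * x ->
  phi (x * y) = phi x * phi y /\ phi x * phi y = phi y * phi x.
Proof.
move=> xy; have [pxy|pxy] := hphi x y.
  by split=> //; exact: half_hom_comm_aux.
have e : phi y * phi x = phi x * phi y.
  by apply: half_hom_comm_aux => //; rewrite -xy.
by rewrite pxy e.
Qed.

Hypothesis phi_inj : injective phi.

Lemma half_hom_dichotomy x y :
  phi (x * y) = phi x * phi y /\ phi (y * x) = phi y * phi x \/
  phi (x * y) = phi y * phi x /\ phi (y * x) = phi x * phi y.
Proof.
have [xy|ne] := pselect (x * y = y * x).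
  have [e1 e2] := half_hom_comm xy.
  by left; split; rewrite // -xy e1.
have [e1|e1] := hphi x y; have [e2|e2] := hphi y x; try by [left|right];
  by case: ne; apply: phi_inj; rewrite e1 e2.
Qed.

Lemma half_hom_mul x y :
  phi x * phi y = phi (x * y) \/ phi x * phi y = phi (y * x).
Proof. by case: (half_hom_dichotomy x y) => -[-> ->]; [left|right]. Qed.

(** On failure, [x(yx)] and [(xy)x] together force a value that [x(xy)] must take too, so by
    injectivity [x] and [y] commute. *)
Lemma half_hom_sandwich x y : phi (x * (y * x)) = phi x * (phi y * phi x).
Proof.
apply: contrapT => ne.
have [e1 e2] : phi (x * (y * x)) = (phi y * phi x) * phi x /\
               phi (x * (y * x)) = phi x * (phi x * phi y).
  have := moufang_flex mQ' (phi x) (phi y).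
  have := moufang_flex mQ x y.
  have [[pxy pyx]|[pxy pyx]] := half_hom_dichotomy x y => f f';
  have [] := hphi x (y * x); have [] := hphi (x * y) x; rewrite pxy pyx f;
  by split; congruence.
have : x * y = y * x.
  apply: (@loopIl _ x); apply: phi_inj.
  have sq : phi (x * x) = phi x * phi x by case: (hphi x x).
  rewrite (left_alternative mQ).
  have [->|->] := hphi (x * x) y; rewrite sq.
    by rewrite e2 left_alternative.
  by rewrite e1 right_alternative.
move=> /half_hom_comm[_ e].
by case: ne; rewrite e1 -e moufang_flex // e.
Qed.

(** * Straight and twisted pairs *)

Definition straight x y :=
  [/\ x * y <> y * x, phi (x * y) = phi x * phi y & phi (y * x) = phi y * phi x].

(* By conversion, this is [straight] for [phi] seen as a map to [opposite Q'];
   every lemma below thus has a dual exchanging [straight] and [twisted]. *)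
Definition twisted x y :=
  [/\ x * y <> y * x, phi (x * y) = phi y * phi x & phi (y * x) = phi x * phi y].

Lemma straight_sym x y : straight x y -> straight y x.
Proof. by case=> ne *; split=> // /esym. Qed.

Lemma twisted_sym x y : twisted x y -> twisted y x.
Proof. by case=> ne *; split=> // /esym. Qed.

Lemma straight_or_twisted x y : x * y <> y * x -> straight x y \/ twisted x y.
Proof. by move=> ne; case: (half_hom_dichotomy x y) => -[]; [left|right]. Qed.

Lemma straightP x y :
  x * y <> y * x -> phi (x * y) = phi x * phi y -> straight x y.
Proof.
move=> ne pxy; case: (straight_or_twisted ne) => // -[_ pxy' pyx].
by case: ne; apply: phi_inj; rewrite pxy pyx.
Qed.

Lemma straight_mulr x y : straight x y -> straight x (y * x).
Proof.
case=> ne _ pyx; apply: straightP; last by rewrite half_hom_sandwich pyx.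
by rewrite -moufang_flex // => /loopIr.
Qed.

(** [y(xx) = (yx)x], and [(x, yx)] is straight by [straight_mulr]. *)
Lemma straight_sqr x y : x * x * y <> y * (x * x) ->
  straight x y -> straight (x * x) y.
Proof.
move=> nc sxy; apply/straight_sym/straightP; first exact/nesym.
have [_ _ pyx] := sxy; have [_ _ pyxx] := straight_mulr sxy.
have -> : phi (x * x) = phi x * phi x by case: (hphi x x).
by rewrite -right_alternative // pyxx pyx right_alternative.
Qed.

(* Here [w] is [x y x^-1], and the conclusion says that it is [z^-1 y z]. *)
Lemma apex_conj x y z w : straight x y -> twisted x z ->
  phi (y * z) = phi y * phi z -> w * x = x * y -> z * w = y * z.
Proof.
move=> [_ pxy _] [nxz pxz _] pyz wx.
have := mQ' (phi x) (phi y) (phi z).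
rewrite -pyz -half_hom_sandwich -pxy -pxz.
(* The order [(xy)(xz)] would give [xz = zx]; the order [(xz)(xy)] gives the conclusion. *)
case: (half_hom_mul (x * y) (x * z)) => -> /phi_inj.
  by rewrite -mQ => /loopIl.
by rewrite -wx !mQ => /loopIl /loopIr.
Qed.

(** Otherwise [apex_conj] reads [zw = zy], so [w = y] and [x] commutes with [y]. *)
Lemma straight_twisted_comm x y z : straight x y -> twisted x z ->
  y * z <> z * y.
Proof.
move=> sxy txz yz; have [w [wx _]] := rdiv_unique x (x * y).
have := apex_conj sxy txz (half_hom_comm yz).1 wx; rewrite yz => /loopIl e.
by case: sxy => ne _ _; apply: ne; rewrite -wx e.
Qed.

(** Otherwise [y] is straight with [dn] and twisted with [d], yet these two commute. *)
Lemma straight_divr_nucleus d n y : nucleus Q n -> n * d = d * n ->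
  n * y = y * n -> straight (d * n) y -> straight d y.
Proof.
move=> Nn nd ny s.
have nc : d * y <> y * d.
  case: s => ne _ _ dy; apply: ne.
  have [_ -> _] := Nn d y; have [_ _ <-] := Nn y d.
  by rewrite ny -dy; have [_ _ <-] := Nn d y.
case: (straight_or_twisted nc) => // /twisted_sym t.
case: (straight_twisted_comm (straight_sym s) t).
by have [_ -> _] := Nn d d; rewrite nd.
Qed.

End HalfHomomorphism.

Lemma half_homomorphism_opposite (Q Q' : loopType) (phi : Q -> Q') :
  half_homomorphism phi ->
  @half_homomorphism Q (opposite Q') phi.
Proof. by move=> h x y; case: (h x y); [right|left]. Qed.

(** * Mixed elements and the nucleus *)

Section NuclearNeighbor.
Variables (Q Q' : loopType) (mQ : moufang Q) (mQ' : moufang Q').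
Variables (phi : Q -> Q') (hphi : half_homomorphism phi).
Hypothesis phi_inj : injective phi.
Implicit Types c n w x y z : Q.

Let hphi' := half_homomorphism_opposite hphi.
Let mQ'o := opposite_moufang mQ'.

Lemma straight_not_twisted_nucleus x y n : nucleus Q n ->
  straight phi x y -> ~ twisted phi x n.
Proof.
move=> Nn sxy txn.
have [[pyn _]|[_ pny]] := half_hom_dichotomy mQ mQ' hphi phi_inj y n.
  have [w [wx _]] := rdiv_unique x (x * y).
  have e := apex_conj mQ mQ' hphi phi_inj sxy txn pyn wx.
  (* [y] commutes with [nx], since [y(nx) = (nw)x = n(xy)]. *)
  have txnx : twisted phi x (n * x).
    exact: (straight_mulr mQ mQ'o hphi' phi_inj txn).
  apply: (straight_twisted_comm mQ mQ' hphi phi_inj sxy txnx).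
  have [_ <- _] := Nn y x; have [-> _ _] := Nn x y.
  by rewrite -e -wx; have [-> _ _] := Nn w x.
(* Dually, [n] is conjugated by [x]. Normality keeps the conjugate [w] nuclear, and [n] turns out to
   commute with [yx]. *)
have : rcoset (nucleus Q) x (x * n).
  by rewrite -(normalJ (nucleus_normal mQ)); exists n.
case=> w Nw wx.
have e : y * w = n * y.
  exact: (apex_conj mQ mQ'o hphi' phi_inj txn sxy pny wx).
have syx := straight_mulr mQ mQ' hphi phi_inj sxy.
apply: (straight_twisted_comm mQ mQ' hphi phi_inj syx txn).
have [_ _ ->] := Nn y x; rewrite -wx; have [_ <- _] := Nw y x.
by rewrite e; have [-> _ _] := Nn y x.
Qed.

End NuclearNeighbor.

Section Mixed.
Variables (Q Q' : loopType) (mQ : moufang Q) (mQ' : moufang Q').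
Variables (phi : Q -> Q') (hphi : half_homomorphism phi).
Hypothesis phi_inj : injective phi.
Implicit Types c n w x y z : Q.

Let hphi' := half_homomorphism_opposite hphi.
Let mQ'o := opposite_moufang mQ'.

Lemma mixed_nucleus_comm x y z n : nucleus Q n ->
  straight phi x y -> twisted phi x z -> x * n = n * x.
Proof.
move=> Nn sxy txz; apply: contrapT => ne.
have [s|t] := straight_or_twisted mQ mQ' hphi phi_inj ne.
  exact: (straight_not_twisted_nucleus mQ mQ'o hphi' phi_inj Nn txz s).
exact: (straight_not_twisted_nucleus mQ mQ' hphi phi_inj Nn sxy t).
Qed.

Lemma apex_nucleus_comm x y z n : nucleus Q n ->
  straight phi x y -> twisted phi x z -> straight phi y z -> n * y = y * n.
Proof.
move=> Nn sxy txz syz.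
have xn := mixed_nucleus_comm Nn sxy txz.
have zn := mixed_nucleus_comm Nn (straight_sym syz) (twisted_sym txz).
have nc : x * (n * z) <> (n * z) * x.
  case: txz => ne _ _; have [_ <- _] := Nn x z; rewrite xn.
  by have [-> _ _] := Nn x z; have [-> _ _] := Nn z x => /loopIl.
have txnz : twisted phi x (n * z).
  have [s|//] := straight_or_twisted mQ mQ' hphi phi_inj nc.
  case: (straight_twisted_comm mQ mQ' hphi phi_inj s txz).
  by rewrite -{1}zn; have [_ -> _] := Nn z z.
have nc' := straight_twisted_comm mQ mQ' hphi phi_inj sxy txnz.
(* If [(y, nz)] is twisted, [y] is itself mixed and so commutes with [n]. *)
have [[_ pynz _]|t] := straight_or_twisted mQ mQ' hphi phi_inj nc'; last first.
  by rewrite (mixed_nucleus_comm Nn (straight_sym sxy) t).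
have [w [wx _]] := rdiv_unique x (x * y).
have [_ pyz _] := syz.
have e := apex_conj mQ mQ' hphi phi_inj sxy txz pyz wx.
have := apex_conj mQ mQ' hphi phi_inj sxy txnz pynz wx.
have [-> _ _] := Nn z w; rewrite e.
by have [<- <- _] := Nn y z => /loopIr.
Qed.

(** Otherwise [(cc, y)] is also twisted by the dual of [straight_sqr], against
    [straight_twisted_comm] with [z = y]. *)
Lemma straight_sqrt c y : straight phi (c * c) y -> straight phi c y.
Proof.
move=> s; have [nc _ _] := s.
have nc' : c * y <> y * c.
  move=> cy; apply: nc.
  by rewrite -left_alternative // cy -moufang_flex // cy right_alternative.
have [//|t] := straight_or_twisted mQ mQ' hphi phi_inj nc'.
have t2 : twisted phi (c * c) y.
  exact: (straight_sqr mQ mQ'o hphi' phi_inj nc t).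
by case: (straight_twisted_comm mQ mQ' hphi phi_inj s t2).
Qed.

End Mixed.

(** * Squares times nuclear elements *)

Section SquareTimesNuclear.
Variables (Q Q' : loopType) (mQ : moufang Q) (mQ' : moufang Q').
Variables (phi : Q -> Q') (hphi : half_homomorphism phi).
Hypothesis phi_inj : injective phi.
Implicit Types c n w x y z : Q.

Let hphi' := half_homomorphism_opposite hphi.
Let mQ'o := opposite_moufang mQ'.

Lemma sqr_nucleus_apex c n y z : nucleus Q n ->
  straight phi (c * c * n) y -> twisted phi (c * c * n) z ->
  ~ straight phi y z.
Proof.
set d := c * c; set x := d * n => Nn sxy txz syz; have [_ pyz _] := syz.
have ny := apex_nucleus_comm mQ mQ' hphi phi_inj Nn sxy txz syz.
have zn := mixed_nucleus_comm mQ mQ' hphi phi_inj Nn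
  (straight_sym syz) (twisted_sym txz).
have nd : n * d = d * n.
  apply: (@loopIr _ n); have [-> _ _] := Nn d n.
  by rewrite (mixed_nucleus_comm mQ mQ' hphi phi_inj Nn sxy txz).
have scy : straight phi c y.
  apply: straight_sqrt => //.
  exact: straight_divr_nucleus Nn nd ny sxy.
have tcz : twisted phi c z.
  apply: (straight_sqrt mQ mQ'o hphi' phi_inj).
  exact: (straight_divr_nucleus mQ mQ'o hphi' phi_inj Nn nd (esym zn) txz).
have [w [wc _]] := rdiv_unique c (c * y).
have [u [ux _]] := rdiv_unique x (x * y).
have uw : u = w.
  apply: (@loopIl _ z).
  rewrite (apex_conj mQ mQ' hphi phi_inj sxy txz pyz ux).
  by rewrite (apex_conj mQ mQ' hphi phi_inj scy tcz pyz wc).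
have wd : w * d = d * y.
  apply: (@loopIr _ n); have [_ _ ->] := Nn w d; have [_ _ ->] := Nn d y.
  by rewrite -uw ux -ny; have [_ -> _] := Nn d y.
(* Both [c] and [cc] conjugate [y] to [w], so [c] conjugates [w] to itself. *)
have wC : w * c = c * w.
  apply: (@loopIr _ c); rewrite (right_alternative mQ) wd.
  by rewrite -(left_alternative mQ) -wc -(moufang_flex mQ).
case: scy => ne _ _; apply: ne; rewrite -wc; congr (_ * _).
by apply: (@loopIl _ c); rewrite -wC wc.
Qed.

End SquareTimesNuclear.

(** * Absence of mixed elements and the conclusion *)

Unset Implicit Arguments.

Theorem theorem1p4 (Q Q' : loopType) (mQ : moufang Q) (mQ' : moufang Q')
    (sqN : squaring_surjective (factor (nucleus_normal mQ)))
    (phi : Q -> Q') (hphi : half_isomorphism phi) :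
  isomorphism phi \/ anti_isomorphism phi.
Proof.
have [bphi hh] := hphi; have inj := bij_inj bphi.
have sqr x : exists c n, nucleus Q n /\ x = c * c * n.
  have [D] := sqN (factor_pi _ x); elim/factor_ind: D => c.
  rewrite -factor_piM => /esym /factor_pi_mem[n Nn e].
  by exists c, n.
have unmixed x y z : straight phi x y -> ~ twisted phi x z.
  have [c [n [Nn ->]]] := sqr x => s t.
  have nc := straight_twisted_comm mQ mQ' hh inj s t.
  have [syz|tyz] := straight_or_twisted mQ mQ' hh inj nc.
    exact: (sqr_nucleus_apex mQ mQ' hh inj Nn s t syz).
  exact: (sqr_nucleus_apex mQ (opposite_moufang mQ')
    (half_homomorphism_opposite hh) inj Nn t s (twisted_sym tyz)).
apply: contrapT => /not_orP[niso nanti].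
have [[x y] sxy] : exists p, straight phi p.1 p.2.
  apply: contrapT => ns; apply: nanti; split=> // x y.
  have [[pxy pyx]|[//]] := half_hom_dichotomy mQ mQ' hh inj x y.
  have [xy|ne] := pselect (x * y = y * x); first by rewrite xy.
  by case: ns; exists (x, y).
have [[z w] tzw] : exists p, twisted phi p.1 p.2.
  apply: contrapT => ns; apply: niso; split=> // z w.
  have [[//]|[pzw pwz]] := half_hom_dichotomy mQ mQ' hh inj z w.
  have [zw|ne] := pselect (z * w = w * z); first by rewrite zw.
  by case: ns; exists (z, w).
rewrite /= in sxy tzw.
have comm a b u v : straight phi a u -> twisted phi b v -> a * b = b * a.
  move=> s t; apply: contrapT => ne.
  have [s'|t'] := straight_or_twisted mQ mQ' hh inj ne.
    exact: unmixed (straight_sym s') t.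
  exact: unmixed s t'.
have xz := comm _ _ _ _ sxy tzw.
have yz := comm _ _ _ _ (straight_sym sxy) tzw.
have xw := comm _ _ _ _ sxy (twisted_sym tzw).
have mulE a b : a * b = b * a -> phi (a * b) = phi a * phi b.
  by move=> /(half_hom_comm mQ mQ' hh)[].
(* [(zx)(yz) = z((xy)z)] inherits its order from [(x, y)], as [z] commutes with [x] and [y]. *)
have s : straight phi (z * x) (y * z).
  have [ne pxy _] := sxy; apply: straightP => //.
    by rewrite mQ yz -xz mQ => /loopIl /loopIr.
  by rewrite mQ half_hom_sandwich // pxy -mQ' (mulE _ _ (esym xz)) (mulE _ _ yz).
have t : twisted phi (z * x) (x * w).
  have [ne pzw _] := tzw.
  have e : (z * x) * (x * w) = x * ((z * w) * x) by rewrite xw -xz mQ.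
  apply: (@straightP Q (opposite Q') mQ (opposite_moufang mQ') phi
    (half_homomorphism_opposite hh) inj).
    by rewrite e mQ => /loopIl /loopIr.
  have : phi ((z * x) * (x * w)) = phi (x * w) * phi (z * x).
    by rewrite e half_hom_sandwich // pzw -mQ' (mulE _ _ xw) (mulE _ _ (esym xz)).
  exact.
exact: unmixed s t.
Qed.
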